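(* Let $R$ be a (two-sided) perfect ring and let $T$ be a left $R$-module. Then $T$ is a tilting module if and only if $T^{\bot_{0\le i\le 1}}=0$ and $\mathrm{Gen}\,T\subseteq T^{\bot_{1\le i\le 2}}$.
   Context: A ring $R$ is left (resp. right) perfect if every left (resp. right) $R$-module has a projective cover, and perfect if it is both. Modules are left $R$-modules, not necessarily finitely generated. $\mathrm{Add}\,T$ is the class of modules isomorphic to direct summands of (arbitrary) direct sums of copies of $T$; $\mathrm{Gen}\,T$ is the class of all epimorphic images of modules in $\mathrm{Add}\,T$. For a set $I$ of non-negative integers, $T^{\bot_I}$ is the class of all modules $M$ with $\mathrm{Ext}^i_R(T,M)=0$ for all $i\in I$, where $\mathrm{Ext}^0_R:=\mathrm{Hom}_R$. So $T^{\bot_1}$, $T^{\bot_{0\le i\le 1}}$ and $T^{\bot_{1\le i\le 2}}$ correspond to $I=\{1\}$, $\{0,1\}$ and $\{1,2\}$; ''$T^{\bot_{0\le i\le 1}}=0$'' means that this class contains only the zero module. $T$ is tilting if $\mathrm{Gen}\,T=T^{\bot_1}$; equivalently, if (T1) $T$ has projective dimension at most one, (T2) $\mathrm{Ext}^1_R(T,T^{(J)})=0$ for every set $J$ (where $T^{(J)}$ is the direct sum of $J$ copies of $T$), and (T3) there is an exact sequence $0\to R\to T_0\to T_1\to 0$ with $T_0,T_1\in\mathrm{Add}\,T$. *)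

(* Defs.v *)
From HB Require Import structures.
From mathcomp Require Import all_boot finmap ssralg generic_quotient ring_quotient.
From mathcomp Require Import boolp classical_sets functions cardinality fsbigop.

Set Implicit Arguments.
Unset Strict Implicit.
Unset Printing Implicit Defensive.

Import GRing.Theory.

Local Open Scope ring_scope.
Local Open Scope classical_set_scope.

(* A "module" is a left module: lmodType R, over a ring R that need not be
   commutative and may be zero.  The choice structure carried by an lmodType is
   no restriction: every type has one classically (boolp.gen_choiceMixin).
   Classes of modules are predicates lmodType R -> Prop. *)

Definition is_zero (V : zmodType) : Prop := forall x : V, x = 0.

Definition epi (R : pzRingType) (M N : lmodType R) (f : {linear M -> N}) : Prop :=
  forall y : N, exists x : M, f x = y.

Section DirectPower.
Variables (R : pzRingType) (J : Type) (M : lmodType R).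

Definition fin_supp : {pred J -> M} :=
  fun f => `[< finite_set [set j | f j != 0] >].

Lemma fin_supp_closed : GRing.submod_closed fin_supp.
Proof.
split=> [|a f g].
  apply/asboolP; rewrite [X in finite_set X](_ : _ = set0) //.
  by apply/seteqP; split=> j //=; rewrite eqxx.
move=> /asboolP finf /asboolP fing; apply/asboolP.
have fin_fg : finite_set ([set j | f j != 0] `|` [set j | g j != 0]).
  by rewrite finite_setU.
apply: sub_finite_set fin_fg => j /= nz; apply/orP; apply: contra_neqT nz.
by rewrite negb_or !negbK => /andP[/eqP fj0 /eqP gj0];
  rewrite /GRing.add /GRing.scale /= fj0 gj0 scaler0 addr0.
Qed.

HB.instance Definition _ :=
  GRing.isSubmodClosed.Build R (J -> M) fin_supp fin_supp_closed.

(* The direct sum M^(J) of J copies of M *)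
Record dsum := DSum { dsum_fun :> J -> M; _ : dsum_fun \in fin_supp }.

HB.instance Definition _ := [isSub for dsum_fun].
HB.instance Definition _ := [Choice of dsum by <:].
HB.instance Definition _ := [SubChoice_isSubLmodule of dsum by <:].
End DirectPower.

Section Classes.
Variables (R : pzRingType) (T : lmodType R).

Definition Add (M : lmodType R) : Prop :=
  exists (J : Type) (N : lmodType R) (f : {linear (M * N)%type -> dsum J T}),
    bijective f.

Definition Gen (M : lmodType R) : Prop :=
  exists (A : lmodType R) (f : {linear A -> M}), Add A /\ epi f.
End Classes.

Section PerfectRings.
Variable R : pzRingType.

Definition projective (P : lmodType R) : Prop :=
  forall (M N : lmodType R) (g : {linear M -> N}) (f : {linear P -> N}),
    epi g -> exists h : {linear P -> M}, forall x, g (h x) = f x.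

Definition superfluous (P : lmodType R) (K : {pred P}) : Prop :=
  forall N : {pred P}, GRing.submod_closed N ->
    (forall x, exists k n, [/\ k \in K, n \in N & x = k + n]) ->
    forall x, x \in N.

Definition projective_cover (P M : lmodType R) (f : {linear P -> M}) : Prop :=
  [/\ projective P, epi f & superfluous [pred x | f x == 0]].

Definition left_perfect : Prop :=
  forall M : lmodType R,
    exists (P : lmodType R) (f : {linear P -> M}), projective_cover f.
End PerfectRings.

(* Right R-modules are left modules over the converse ring R^c. *)
Definition right_perfect (R : pzRingType) : Prop := left_perfect R^c.

Definition perfect (R : pzRingType) : Prop := left_perfect R /\ right_perfect R.

Section Hom.
Variables (R : pzRingType) (M N : lmodType R).

Definition Hom : Type := {linear M -> N}.

HB.instance Definition _ := gen_eqMixin Hom.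
HB.instance Definition _ := gen_choiceMixin Hom.

Definition hom0 : Hom := \0.
Definition homD (f g : Hom) : Hom := f \+ g.
Definition homN (f : Hom) : Hom := \- f.

Lemma hom_ext (f g : Hom) : f =1 g -> f = g.
Proof.
move=> fg; have {fg} : (f : M -> N) = g by apply: funext.
case: f g => [f [[+] [+]]] [g [[+] [+]]] /= efg.
move: efg => -> *; do !f_equal; exact: Prop_irrelevance.
Qed.

Fact homDA : associative homD.
Proof. by move=> f g h; apply: hom_ext => x /=; rewrite addrA. Qed.

Fact homDC : commutative homD.
Proof. by move=> f g; apply: hom_ext => x /=; rewrite addrC. Qed.

Fact hom0D : left_id hom0 homD.
Proof. by move=> f; apply: hom_ext => x /=; rewrite add0r. Qed.

Fact homND : left_inverse hom0 homN homD.
Proof. by move=> f; apply: hom_ext => x /=; rewrite addNr. Qed.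

HB.instance Definition _ := GRing.isZmodule.Build Hom homDA homDC hom0D homND.

Lemma hom0E x : (0 : Hom) x = 0.
Proof. by []. Qed.

Lemma homBE (f g : Hom) x : (f - g) x = f x - g x.
Proof. by []. Qed.

End Hom.

Section Kernel.
Variables (R : pzRingType) (M N : lmodType R) (f : {linear M -> N}).

Definition ker_pred : {pred M} := fun x => f x == 0.

Fact ker_closed : GRing.submod_closed ker_pred.
Proof.
split=> [|a x y]; rewrite !unfold_in ?linear0 // => /eqP fx0 /eqP fy0.
by rewrite linearP fx0 fy0 scaler0 addr0.
Qed.

HB.instance Definition _ := GRing.isSubmodClosed.Build R M ker_pred ker_closed.

Record ker := Ker { ker_val : M; _ : ker_val \in ker_pred }.

HB.instance Definition _ := [isSub for ker_val].
HB.instance Definition _ := [Choice of ker by <:].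
HB.instance Definition _ := [SubChoice_isSubLmodule of ker by <:].
End Kernel.

Section StandardResolution.
Variable R : pzRingType.

Definition free (X : Type) : lmodType R := dsum X (R^o : lmodType R).

(* The canonical map from the free module on the set M to M; the sum over all
   of M is a sum over the finite support of c. *)
Definition aug_fun (M : lmodType R) (c : free M) : M :=
  \sum_(x \in [set: M]) (c x : R) *: x.

Lemma aug_funE (M : lmodType R) (c : free M) (A : set M) :
  finite_set A -> (forall x, c x != 0 -> A x) ->
  aug_fun c = \sum_(x <- fset_set A) (c x : R) *: x.
Proof.
move=> finA suppA; rewrite /aug_fun -fsbig_finite //.
apply/esym/fsbig_widen => // x [_ nAx] /=.
by apply/eqP; apply: contra_notT nAx => nz; apply: suppA;
  apply: contra_neq nz => ->; rewrite scale0r.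
Qed.

Lemma supp_finite (X : Type) (c : free X) : finite_set [set x | c x != 0].
Proof. by case: c => c /= /asboolP. Qed.

Fact aug_fun_linear M : linear (@aug_fun M).
Proof.
move=> a c e; pose A := [set x | c x != 0] `|` [set x | e x != 0].
have finA : finite_set A by rewrite finite_setU; split; apply: supp_finite.
have aceE x : (a *: c + e : free M) x = (a * (c x : R) + (e x : R)) by [].
rewrite !(@aug_funE _ _ A) //.
- rewrite scaler_sumr -big_split; apply: eq_bigr => x _.
  by rewrite aceE scalerDl scalerA.
- by move=> x nz; right.
- by move=> x nz; left.
- move=> x; rewrite aceE => nz; apply/orP; apply: contra_neqT nz.
  by rewrite negb_or !negbK => /andP[/eqP-> /eqP->]; rewrite mulr0 addr0.
Qed.

HB.instance Definition _ (M : lmodType R) :=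
  GRing.isLinear.Build R (free M) M *:%R (@aug_fun M) (@aug_fun_linear M).

Definition aug (M : lmodType R) : {linear free M -> M} := @aug_fun M.

(* The free resolution ... -> F_2 -> F_1 -> F_0 -> T -> 0 in which F_n is free
   on the n-th syzygy K_n, where K_0 = T and K_{n+1} = ker (F_n -> K_n); the
   differential F_{n+1} -> F_n is the composite F_{n+1} -> K_{n+1} -> F_n. *)
Fixpoint syz (T : lmodType R) (n : nat) : lmodType R :=
  if n is m.+1 then ker (aug (syz T m)) else T.

Definition res (T : lmodType R) (n : nat) : lmodType R := free (syz T n).

Definition diff (T : lmodType R) (n : nat) : {linear res T n.+1 -> res T n} :=
  (val : ker (aug (syz T n)) -> res T n) \o aug (syz T n.+1).

End StandardResolution.

(* Cohomology of Hom(F_0, M) -> Hom(F_1, M) -> Hom(F_2, M) -> ... in degree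
   n + 1, F being the resolution [res T] *)
Section Cohomology.
Variables (R : pzRingType) (T M : lmodType R) (n : nat).

Definition cocycle_pred : {pred Hom (res T n.+1) M} :=
  fun f => `[< forall x, f (diff T n.+1 x) = 0 >].

Fact cocycle_closed : zmod_closed cocycle_pred.
Proof.
split=> [|f g /asboolP f0 /asboolP g0]; apply/asboolP => x //.
by rewrite homBE f0 g0 subr0.
Qed.

HB.instance Definition _ :=
  GRing.isZmodClosed.Build (Hom (res T n.+1) M) cocycle_pred cocycle_closed.

Record cocycle :=
  Cocycle { cocycle_hom : Hom (res T n.+1) M; _ : cocycle_hom \in cocycle_pred }.

HB.instance Definition _ := [isSub for cocycle_hom].
HB.instance Definition _ := [Choice of cocycle by <:].
HB.instance Definition _ := [SubChoice_isSubZmodule of cocycle by <:].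

Definition coboundary : {pred cocycle} :=
  fun f => `[< exists g : Hom (res T n) M,
                 forall x, cocycle_hom f x = g (diff T n x) >].

Fact coboundary_closed : zmod_closed coboundary.
Proof.
split=> [|f g /asboolP[f' ff'] /asboolP[g' gg']]; apply/asboolP.
  by exists 0 => x.
by exists (f' - g') => x; rewrite homBE -ff' -gg'.
Qed.

HB.instance Definition _ :=
  GRing.isZmodClosed.Build cocycle coboundary coboundary_closed.

Definition cohomology : zmodType := Quotient.quot coboundary.
End Cohomology.

Definition Ext (R : pzRingType) (i : nat) (T M : lmodType R) : zmodType :=
  if i is n.+1 then cohomology T M n else Hom T M.

Definition perp (R : pzRingType) (I : set nat) (T M : lmodType R) : Prop :=
  forall i, I i -> is_zero (Ext i T M).

Definition tilting (R : pzRingType) (T : lmodType R) : Prop :=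
  forall M : lmodType R, Gen T M <-> perp [set 1%N] T M.

(* Main.v *)
From HB Require Import structures.
Require Import Defs.
From mathcomp Require Import all_boot finmap ssralg ring_quotient.
From mathcomp Require Import boolp classical_sets cardinality fsbigop.

(** Everything reduces to extension problems.  Computed from the free resolution
    F with syzygies K_n (K_0 = T), the group Ext^(n+1)(T, M) vanishes exactly
    when every map K_(n+1) -> M extends along the inclusion K_(n+1) -> F_n
    ([ext_zeroP]), and the parts of the long exact sequence that are needed
    become short diagram chases with extensions and liftings.

    Suppose the orthogonality conditions hold.  Modules in Gen T have vanishing
    Ext^1, so let M have vanishing Ext^1 and let L be its trace, the sum of the
    images of all maps T -> M; as a quotient of a direct sum of copies of T, it
    lies in Gen T ([trace_short_exact]).  A map T -> M/L lifts to M because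
    Ext^1(T, L) = 0, hence lands in L and is zero, while Ext^1(T, M/L) is caught
    between Ext^1(T, M) = 0 and Ext^2(T, L) = 0 ([ext_zero_quotient]).  So M/L is orthogonal to T in
    degrees 0 and 1, whence M = L is in Gen T.

    Suppose T is tilting.  A module in Gen T to which T maps only by zero is
    zero ([Gen_hom_zero]), and this gives the first condition.  For the second,
    Ext^2(T, M) = 0 for every M ([tilting_ext1]): one embeds M in a module E with
    Ext^1(T, E) = 0 in which the given map K_2 -> M becomes extendable to F_1.
    Then E is in Gen T, so is E/M, thus Ext^1(T, E/M) = 0, and dimension shifting
    ([ext_zero_shift]) brings the extension back into M.  Such an E is built by
    two pushouts: one along K_2 -> F_1 to make the extension exist, and then the
    universal extension by copies of T to kill Ext^1, as in Bongartz's lemma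
    ([ext_zero_envelope]).  The latter works because Ext^1(T, T^(X)) = 0. *)

Set Implicit Arguments.
Unset Strict Implicit.
Unset Printing Implicit Defensive.

Import GRing.Theory.

Local Open Scope ring_scope.
Local Open Scope classical_set_scope.

(** * Constructing linear maps *)

Lemma linear_bundle (R : pzRingType) (M N : lmodType R) (f : M -> N) :
  linear f -> exists g : {linear M -> N}, forall x, g x = f x.
Proof.
move=> f_lin.
pose g : {linear M -> N} := HB.pack f (GRing.isLinear.Build R M N *:%R f f_lin).
by exists g.
Qed.

(** A linear functional relation is the graph of a linear map.  Induced maps, to a
    submodule or from a quotient, are given by such relations, without choosing
    representatives in a linear way. *)
Lemma linear_of_rel (R : pzRingType) (M N : lmodType R) (r : M -> N -> Prop) :
  (forall x, exists y, r x y) ->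
  (forall x y y', r x y -> r x y' -> y = y') ->
  (forall a x y x' y', r x y -> r x' y' -> r (a *: x + x') (a *: y + y')) ->
  exists f : {linear M -> N}, forall x, r x (f x).
Proof.
move=> /choice[f rf] r_fun r_lin.
have [|g gE] := @linear_bundle _ _ _ f.
  by move=> a x x'; apply: r_fun (rf _) (r_lin _ _ _ _ _ _ _).
by exists g => x; rewrite gE.
Qed.

Section Factorisation.
Variables (R : pzRingType) (L M N : lmodType R).

Lemma factor_through_epi (p : {linear M -> N}) (f : {linear M -> L}) :
  epi p -> (forall x, p x = 0 -> f x = 0) ->
  exists g : {linear N -> L}, forall x, g (p x) = f x.
Proof.
move=> p_epi kerpf.
have fE x x' : p x = p x' -> f x = f x'.
  move=> pxx'; apply/eqP; rewrite -subr_eq0 -linearB; apply/eqP/kerpf.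
  by rewrite linearB pxx' subrr.
have [|y z z'|a y z y' z'|g gP] :=
  linear_of_rel (r := fun y z => exists2 x, p x = y & f x = z).
- by move=> y; have [x <-] := p_epi y; exists (f x), x.
- by move=> [x <- <-] [x' /fE-> <-].
- by move=> [x <- <-] [x' <- <-]; exists (a *: x + x'); rewrite linearP.
by exists g => x; have [x' /fE-> <-] := gP (p x).
Qed.

Lemma factor_through_mono (j : {linear M -> N}) (f : {linear L -> N}) :
  (forall x, j x = 0 -> x = 0) -> (forall y, exists x, j x = f y) ->
  exists g : {linear L -> M}, forall y, j (g y) = f y.
Proof.
move=> j_inj jf; apply: (linear_of_rel (r := fun y x => j x = f y)) => //.
- move=> y x x' <- jxx'; apply/eqP; rewrite -subr_eq0; apply/eqP; apply: j_inj.
  by rewrite linearB jxx' subrr.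
- by move=> a y x y' x' jx jx'; rewrite !linearP jx jx'.
Qed.
End Factorisation.

(** * Cokernels *)

Section Cokernel.
Variables (R : pzRingType) (A B : lmodType R) (f : {linear A -> B}).

Definition range_pred : {pred B} := fun y => `[< exists x, f x = y >].

Fact range_closed : GRing.submod_closed range_pred.
Proof.
split=> [|a y y' /asboolP[x <-] /asboolP[x' <-]]; apply/asboolP.
  by exists 0; rewrite linear0.
by exists (a *: x + x'); rewrite linearP.
Qed.

HB.instance Definition _ := GRing.isSubmodClosed.Build R B range_pred range_closed.

Definition coker : Type := Quotient.quot range_pred.
HB.instance Definition _ := GRing.Zmodule.on coker.

Definition coker_pi : B -> coker := \pi_(Quotient.quot range_pred)%qT.

Fact coker_pi_epi q : exists y, q = coker_pi y.
Proof. by exists (repr (q : Quotient.quot range_pred)); rewrite /coker_pi reprK. Qed.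

Fact coker_pi_eq y y' : coker_pi y = coker_pi y' <-> y - y' \in range_pred.
Proof. by rewrite Quotient.idealrBE; split=> /eqP. Qed.

Fact coker_piD : {morph coker_pi : y y' / y + y'}.
Proof. exact: (@pi_addr _ _ _ _ _ (Quotient.quot range_pred)). Qed.

(** The choice of representative is immaterial because the range is closed under
    scaling ([coker_scale_pi]). *)
Definition coker_scale (a : R) (q : coker) : coker :=
  coker_pi (a *: repr (q : Quotient.quot range_pred)).

Fact coker_scale_pi a y : coker_scale a (coker_pi y) = coker_pi (a *: y).
Proof.
apply/coker_pi_eq; rewrite -scalerBr; apply: rpredZ.
by apply/coker_pi_eq; rewrite /coker_pi reprK.
Qed.

Fact coker_scaleA a b q : coker_scale a (coker_scale b q) = coker_scale (a * b) q.
Proof. by have [y ->] := coker_pi_epi q; rewrite !coker_scale_pi scalerA. Qed.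

Fact coker_scale1 : left_id 1 coker_scale.
Proof. by move=> q; have [y ->] := coker_pi_epi q; rewrite coker_scale_pi scale1r. Qed.

Fact coker_scaleDr : right_distributive coker_scale +%R.
Proof.
move=> a p q; have [x ->] := coker_pi_epi p; have [y ->] := coker_pi_epi q.
by rewrite -coker_piD !coker_scale_pi scalerDr coker_piD.
Qed.

Fact coker_scaleDl q : {morph coker_scale^~ q : a b / a + b}.
Proof. by move=> a b; rewrite /coker_scale scalerDl coker_piD. Qed.

HB.instance Definition _ := GRing.Zmodule_isLmodule.Build R coker
  coker_scaleA coker_scale1 coker_scaleDr coker_scaleDl.

(** The interface of the quotient by the range of [f]: later proofs only need that
    some epimorphism has that kernel. *)
Lemma coker_exists : exists (Q : lmodType R) (p : {linear B -> Q}),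
  epi p /\ forall y, p y = 0 <-> exists x, f x = y.
Proof.
have pi_lin : linear coker_pi by move=> a x y; rewrite coker_piD -coker_scale_pi.
have [p pE] := linear_bundle pi_lin.
exists coker, p; split=> [q|y].
  by have [y ->] := coker_pi_epi q; exists y.
rewrite -(linear0 p) !pE; split.
  by move/coker_pi_eq; rewrite subr0 => /asboolP.
by move=> yf; apply/coker_pi_eq; rewrite subr0; apply/asboolP.
Qed.
End Cokernel.

(** * Direct sums *)

Section DirectSum.
Variables (R : pzRingType) (J : Type).

Section Single.
Variable M : lmodType R.

Fact finite_dsum_supp (c : dsum J M) : finite_set [set j | c j != 0].
Proof. by case: c => c /= /asboolP. Qed.

Lemma dsum_ext (c e : dsum J M) : (forall j, c j = e j) -> c = e.
Proof. by move=> ce; apply/val_inj/funext. Qed.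

Lemma dsum_of_fun (f : J -> M) :
  finite_set [set j | f j != 0] -> exists c : dsum J M, forall j, c j = f j.
Proof.
move=> finf; have f_supp : f \in @fin_supp R J M by apply/asboolP.
by exists (DSum f_supp).
Qed.

Lemma dsumPE a (c e : dsum J M) j : (a *: c + e) j = a *: c j + e j.
Proof. by []. Qed.

Fact dsum_in_supp (j : J) (m : M) :
  (fun k => if `[< k = j >] then m else 0) \in @fin_supp R J M.
Proof.
apply/asboolP; apply: sub_finite_set (finite_set1 j) => k /=.
by case: asboolP => // _; rewrite eqxx.
Qed.

(** The inclusion of the [j]-th summand; equality of indices is decided
    classically since [J] is an arbitrary type. *)
Definition dsum_in (j : J) (m : M) : dsum J M := DSum (dsum_in_supp j m).

Lemma dsum_inE j m k : dsum_in j m k = if `[< k = j >] then m else 0.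
Proof. by []. Qed.

Fact dsum_in_linear j : linear (dsum_in j).
Proof.
move=> a m m'; apply: dsum_ext => k; rewrite dsumPE !dsum_inE.
by case: asboolP; rewrite // scaler0 addr0.
Qed.

HB.instance Definition _ j :=
  GRing.isLinear.Build R M (dsum J M) *:%R (dsum_in j) (dsum_in_linear j).

End Single.

Section Copairing.
Variables (M N : lmodType R) (f : J -> {linear M -> N}).

(** The map that the family [f] induces on the direct sum: the sum runs over the
    finite support of [c], and [{classic J}] is [J] with the choice structure that
    the summation requires. *)
Definition copair (c : dsum J M) : N :=
  \sum_(j \in [set: {classic J}]) f j (c j).

Lemma copairE (c : dsum J M) (A : set {classic J}) :
  finite_set A -> (forall j, c j != 0 -> A j) ->
  copair c = \sum_(j <- fset_set A) f j (c j).
Proof.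
move=> finA suppA; rewrite /copair -fsbig_finite //.
apply/esym/fsbig_widen => // j [_ nAj] /=.
have -> : c j = 0 by apply/eqP; apply: contra_notT nAj; apply: suppA.
by rewrite linear0.
Qed.

Fact copair_linear : linear copair.
Proof.
move=> a c e; pose A : set {classic J} := [set j | c j != 0] `|` [set j | e j != 0].
have finA : finite_set A by rewrite finite_setU; split; apply: finite_dsum_supp.
rewrite !(@copairE _ A) //.
- rewrite scaler_sumr -big_split; apply: eq_bigr => j _.
  by rewrite dsumPE linearP.
- by move=> j nz; right.
- by move=> j nz; left.
- move=> j; rewrite dsumPE => nz; apply/orP; apply: contra_neqT nz.
  by rewrite negb_or !negbK => /andP[/eqP-> /eqP->]; rewrite scaler0 addr0.
Qed.

HB.instance Definition _ :=
  GRing.isLinear.Build R (dsum J M) N *:%R copair copair_linear.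

Lemma copair_in j m : copair (dsum_in j m) = f j m.
Proof.
rewrite (@copairE _ [set j]) ?fset_set1 ?big_seq_fset1 //.
  by rewrite dsum_inE; case: asboolP.
by move=> k; rewrite dsum_inE; case: asboolP => //; rewrite eqxx.
Qed.
End Copairing.

Lemma dsum_sum_in (M : lmodType R) (c : dsum J M) :
  exists s : seq J, c = \sum_(j <- s) dsum_in j (c j).
Proof.
pose A : set {classic J} := [set j | c j != 0].
have finA : finite_set A by apply: finite_dsum_supp.
exists (fset_set A); apply: dsum_ext => k.
rewrite (big_morph (fun e : dsum J M => e k) (id1 := 0) (op1 := +%R)) //.
have out (j : {classic J}) : j != k -> dsum_in j (c j) k = 0.
  by rewrite dsum_inE; case: asboolP => // ->; rewrite eqxx.
have [kA|kA] := boolP ((k : {classic J}) \in fset_set A).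
  rewrite (bigD1_seq (k : {classic J})) ?fset_uniq //.
  by rewrite (big1 _ _ _ out) [RHS]addr0 dsum_inE asboolT.
rewrite (big1_seq (I := {classic J})) => [|j /andP[_ jA]]; last first.
  by apply: out; apply: contraNneq kA => <-.
apply/eqP; apply: contraNT kA => ck; rewrite in_fset_set //.
exact/mem_set.
Qed.

(** The uniqueness half of the universal property of the direct sum. *)
Lemma dsum_linear_ext (M N : lmodType R) (u v : {linear dsum J M -> N}) :
  (forall j m, u (dsum_in j m) = v (dsum_in j m)) -> forall c, u c = v c.
Proof.
move=> uv c; have [s ->] := dsum_sum_in c.
by rewrite !linear_sum; apply: eq_bigr => j _; apply: uv.
Qed.

Lemma dsum_map_exists (M N : lmodType R) (f : {linear M -> N}) :
  exists F : {linear dsum J M -> dsum J N}, forall c j, F c j = f (c j).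
Proof.
apply: (linear_of_rel (r := fun (c : dsum J M) (d : dsum J N) =>
  forall j, d j = f (c j))).
- move=> c; apply: (dsum_of_fun (f := fun j => f (c j))).
  apply: sub_finite_set (finite_dsum_supp c) => j /=.
  by apply: contra_neq => ->; rewrite linear0.
- by move=> c d d' dE d'E; apply: dsum_ext => j; rewrite dE d'E.
- by move=> a c d c' d' dE d'E j; rewrite !dsumPE dE d'E linearP.
Qed.
End DirectSum.

(** * Short exact sequences *)

Definition short_exact (R : pzRingType) (L M N : lmodType R)
    (j : {linear L -> M}) (p : {linear M -> N}) : Prop :=
  [/\ forall x, j x = 0 -> x = 0, epi p
    & forall y, p y = 0 <-> exists x, j x = y].

Section ShortExact.
Variable R : pzRingType.

Lemma mono_short_exact (L M : lmodType R) (j : {linear L -> M}) :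
  (forall x, j x = 0 -> x = 0) ->
  exists (N : lmodType R) (p : {linear M -> N}), short_exact j p.
Proof. by move=> j_inj; have [N [p [? ?]]] := coker_exists j; exists N, p. Qed.

Definition ker_incl (M N : lmodType R) (f : {linear M -> N}) : {linear ker f -> M} :=
  (val : ker f -> M).

Lemma ker_short_exact (M N : lmodType R) (p : {linear M -> N}) :
  epi p -> short_exact (ker_incl p) p.
Proof.
move=> p_epi; split=> // [x x0|y]; first exact: val_inj.
split=> [/eqP py0|[[x x0] <-]]; first by exists (Ker (py0 : y \in ker_pred p)).
exact/eqP/x0.
Qed.

(** Exactness holds at each index; what remains is to lift families without
    enlarging their supports, which forces the lift of 0 to be 0. *)
Lemma dsum_short_exact (J : Type) (L M N : lmodType R)
    (j : {linear L -> M}) (p : {linear M -> N})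
    (j' : {linear dsum J L -> dsum J M}) (p' : {linear dsum J M -> dsum J N}) :
  (forall c k, j' c k = j (c k)) -> (forall c k, p' c k = p (c k)) ->
  short_exact j p -> short_exact j' p'.
Proof.
move=> j'E p'E [j_inj p_epi ex]; split.
- by move=> c jc; apply: dsum_ext => k; apply: j_inj; rewrite -j'E jc.
- move=> c.
  (* A section of [p] that fixes 0 preserves finite supports. *)
  pose lift y := if y == 0 then 0 else sval (cid (p_epi y)).
  have liftE y : p (lift y) = y.
    by rewrite /lift; case: eqP => [->|_]; [rewrite linear0|case: cid].
  have [|b bE] := @dsum_of_fun R J M (fun k => lift (c k)).
    apply: sub_finite_set (finite_dsum_supp c) => k /=.
    by apply: contra_neq => ck; rewrite /lift ck eqxx.
  by exists b; apply: dsum_ext => k; rewrite p'E bE liftE.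
- move=> c; split=> [pc|[b <-]]; last first.
    by apply: dsum_ext => k; rewrite p'E j'E; apply/ex; exists (b k).
  have /choice[f fE] k : exists x, j x = c k by apply/ex; rewrite -p'E pc.
  have [|b bE] := @dsum_of_fun R J L f.
    apply: sub_finite_set (finite_dsum_supp c) => k /=.
    by apply: contra_neq => ck; apply: j_inj; rewrite fE.
  by exists b; apply: dsum_ext => k; rewrite j'E bE fE.
Qed.

(** The pushout of [i] and [g] is the cokernel of the map (i, -g) from A to B + C.
    Since [i] is injective so is the map [j] from C, and both inclusions have the
    same cokernel D. *)
Lemma pushout (A B C D : lmodType R) (i : {linear A -> B}) (d : {linear B -> D})
    (g : {linear A -> C}) : short_exact i d ->
  exists (P : lmodType R) (j : {linear C -> P}) (h : {linear B -> P})
         (q : {linear P -> D}),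
    [/\ short_exact j q, forall x, h (i x) = j (g x) & forall y, q (h y) = d y].
Proof.
move=> [i_inj d_epi ex].
have [|r rE] := @linear_bundle R A (B * C)%type (fun x => (i x, - g x)).
  by move=> a x x'; congr pair => /=; rewrite linearP // opprD -scalerN.
have [P [p [p_epi pr]]] := coker_exists r.
have [|j jE] := @linear_bundle R C P (fun z => p (0, z)).
  move=> a z z'; rewrite -linearP; congr (p _).
  by congr pair; rewrite /= scaler0 addr0.
have [|h hE] := @linear_bundle R B P (fun y => p (y, 0)).
  move=> a z z'; rewrite -linearP; congr (p _).
  by congr pair; rewrite /= scaler0 addr0.
have pE y z : p (y, z) = h y + j z.
  by rewrite hE jE -linearD; congr (p _); congr pair; rewrite /= (addr0, add0r).
have hi x : h (i x) = j (g x).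
  apply/eqP; rewrite -subr_eq0 -linearN -pE; apply/eqP/pr.
  by exists x; rewrite rE.
have [|q qE] := @factor_through_epi R D _ _ p (d \o fst) p_epi.
  by move=> [y z] /pr[x]; rewrite rE => -[<- _] /=; apply/ex; exists x.
have qh y : q (h y) = d y by rewrite hE qE.
have qj z : q (j z) = 0 by rewrite jE qE /= linear0.
exists P, j, h, q; split=> //; split.
- move=> z; rewrite jE => /pr[x]; rewrite rE => -[/i_inj-> <-].
  by rewrite linear0 oppr0.
- by move=> y; have [x <-] := d_epi y; exists (h x).
- move=> w; split=> [|[z <-]//]; have [[y z] <-] := p_epi w.
  rewrite qE /= => /ex[x <-]; exists (g x + z).
  by rewrite pE hi linearD.
Qed.

End ShortExact.

(** * Free modules *)

Section Free.
Variables (R : pzRingType) (X : Type).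

(** Choose preimages of the images of the basis vectors. *)
Lemma free_projective : projective (free R X).
Proof.
move=> M N p f p_epi.
have /choice[m mE] x : exists m, p m = f (dsum_in x (1 : R^o)) by apply: p_epi.
have /choice[u uE] x : exists u : {linear R^o -> M}, forall r, u r = r *: m x.
  by apply: linear_bundle => a r r'; rewrite scalerDl scalerA.
pose h : {linear free R X -> M} := copair u.
exists h => c; apply: (dsum_linear_ext (u := p \o h)) => {c} x r /=.
rewrite /h /= copair_in uE linearZ mE -linearZ -linearZ /=.
by rewrite [_ *: _]mulr1.
Qed.

Lemma aug_epi (M : lmodType R) : epi (aug M).
Proof.
move=> m; exists (dsum_in m (1 : R^o)).
rewrite /aug /= (@aug_funE _ _ _ [set m]) ?fset_set1 ?big_seq_fset1 //.
  by rewrite dsum_inE asboolT // scale1r.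
by move=> k; rewrite dsum_inE; case: asboolP => //; rewrite eqxx.
Qed.
End Free.

(** * Extensions and syzygies *)

Section Ext.
Variables (R : pzRingType) (T : lmodType R).

Definition syz_incl n : {linear syz T n.+1 -> res T n} := ker_incl (aug (syz T n)).

Lemma syz_short_exact n : short_exact (syz_incl n) (aug (syz T n)).
Proof. exact/ker_short_exact/aug_epi. Qed.

(** The vanishing of Ext^(n+1)(T, M) as an extension property: by exactness, the
    cocycles F_(n+1) -> M are the maps from the syzygy K_(n+1), and the coboundaries
    are those that extend to F_n. *)
Definition ext_zero n (M : lmodType R) : Prop :=
  forall g : {linear syz T n.+1 -> M},
  exists h : {linear res T n -> M}, forall x, h (syz_incl n x) = g x.

Lemma ext_zeroP n (M : lmodType R) : is_zero (Ext n.+1 T M) <-> ext_zero n M.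
Proof.
have [_ _ ex] := syz_short_exact n.+1.
have pi0 (f : cocycle T M n) :
    \pi_(cohomology T M n)%qT f = 0 <-> f \in @coboundary R T M n.
  rewrite -[X in X \in _]subr0 Quotient.idealrBE.
  have <- : \pi_(cohomology T M n)%qT (0 : cocycle T M n) = 0 by apply: pi_zeror.
  by split=> /eqP.
split=> [ext0 g|ext0 q].
  pose f : Hom (res T n.+1) M := g \o aug (syz T n.+1).
  have f_coc : f \in @cocycle_pred R T M n.
    apply/asboolP => x; rewrite /f /= (proj2 (ex _)) ?linear0 //.
    by exists (aug (syz T n.+2) x).
  have /pi0/asboolP[h hE] := ext0 (\pi_(cohomology T M n)%qT (Cocycle f_coc)).
  exists h => k; have [x <-] := @aug_epi R (syz T n.+1) k.
  exact: esym (hE x).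
rewrite -[q]reprK; set f := repr q; apply/pi0/asboolP.
have [g gE] : exists g : {linear syz T n.+1 -> M},
    forall x, g (aug (syz T n.+1) x) = cocycle_hom f x.
  apply: factor_through_epi; first exact: aug_epi.
  move=> x /ex[k <-]; have [y <-] := @aug_epi R (syz T n.+2) k.
  by case: f => f /= /asboolP; apply.
have [h hE] := ext0 g; exists h => x.
by rewrite -gE -hE.
Qed.

Section LongExactSequence.
Variables (L M N : lmodType R) (j : {linear L -> M}) (p : {linear M -> N}).
Hypothesis jp : short_exact j p.

(** The obstruction to lifting a map K_n -> N through [p] is a class in
    Ext^(n+1)(T, L).  Concretely, F_n -> K_n -> N lifts to F_n -> M by projectivity;
    the lift maps K_(n+1) into L, and subtracting an extension of K_(n+1) -> L
    to F_n makes it descend to K_n.  For n = 0 this lifts maps from T. *)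
Lemma ext_zero_lift n : ext_zero n L ->
  forall f : {linear syz T n -> N}, exists g : {linear syz T n -> M},
    forall x, p (g x) = f x.
Proof.
move=> extL f; have [j_inj p_epi ex] := jp.
have [_ augT_epi exK] := syz_short_exact n.
have [u uE] := @free_projective R _ _ _ p (f \o aug (syz T n)) p_epi.
have uK x : exists y, j y = (u \o syz_incl n) x.
  apply/ex; rewrite /= uE /=; have -> : aug (syz T n) (syz_incl n x) = 0.
    by apply/exK; exists x.
  by rewrite linear0.
have [v vE] := factor_through_mono j_inj uK.
have [w wE] := extL v.
have [||g gE] := @factor_through_epi R M _ _ (aug (syz T n)) (u \- (j \o w)).
- exact: augT_epi.
- by move=> x /exK[k <-]; rewrite /= wE vE subrr.
exists g => k; have [x <-] := augT_epi k.
rewrite gE /= linearB /= uE /=; have -> : p (j (w x)) = 0 by apply/ex; exists (w x).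
by rewrite subr0.
Qed.

(** Exactness of Ext^(n+1)(T, M) -> Ext^(n+1)(T, N) -> Ext^(n+2)(T, L). *)
Lemma ext_zero_quotient n : ext_zero n.+1 L -> ext_zero n M -> ext_zero n N.
Proof.
move=> extL extM f; have [g gE] := ext_zero_lift extL f.
by have [h hE] := extM g; exists (p \o h) => x; rewrite /= hE gE.
Qed.

(** Exactness of Ext^(n+1)(T, N) -> Ext^(n+2)(T, L) -> Ext^(n+2)(T, M), for a single
    class: if [g] extends to F_(n+1) with values in M, the extension induces a map
    K_(n+1) -> N.  Once this map is extended to F_n and lifted to M, it corrects
    [h] so that it takes its values in L. *)
Lemma ext_zero_shift n (g : {linear syz T n.+2 -> L})
    (h : {linear res T n.+1 -> M}) :
  ext_zero n N -> (forall x, h (syz_incl n.+1 x) = j (g x)) ->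
  exists f : {linear res T n.+1 -> L}, forall x, f (syz_incl n.+1 x) = g x.
Proof.
move=> extN hE; have [j_inj p_epi ex] := jp.
have [_ augT_epi exK] := syz_short_exact n.+1.
have [||q qE] := @factor_through_epi R N _ _ (aug (syz T n.+1)) (p \o h).
- exact: augT_epi.
- by move=> x /exK[k <-]; rewrite /= hE; apply/ex; exists (g k).
have [q' q'E] := extN q.
have [r rE] := @free_projective R _ _ _ p q' p_epi.
have hr x : exists y, j y = (h \- (r \o syz_incl n \o aug (syz T n.+1))) x.
  by apply/ex; rewrite /= linearB /= rE q'E qE /= subrr.
have [f fE] := factor_through_mono j_inj hr.
exists f => x; apply/eqP; rewrite -subr_eq0; apply/eqP; apply: j_inj.
have x0 : aug (syz T n.+1) (syz_incl n.+1 x) = 0 by apply/exK; exists x.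
rewrite linearB fE /= hE x0 -[ker_val 0]/(syz_incl n 0).
by rewrite (linear0 (syz_incl n)) (linear0 r) subr0 subrr.
Qed.
End LongExactSequence.

(** Bongartz's universal extension.  Let X be the set of all maps K_1 -> C, and push
    out the inclusion K_1^(X) -> F_0^(X) along the evaluation K_1^(X) -> C, giving
    0 -> C -> E -> T^(X) -> 0.  A map K_1 -> E agrees, up to a map that extends to
    F_0, with one into C, because Ext^1(T, T^(X)) = 0; and every map f from K_1
    to C extends to F_0 inside E, through the summand of index f. *)
Lemma ext_zero_envelope (C : lmodType R) :
  (forall X : Type, ext_zero 0 (dsum X T)) ->
  exists (E : lmodType R) (j : {linear C -> E}),
    (forall x, j x = 0 -> x = 0) /\ ext_zero 0 E.
Proof.
move=> extT; pose X := {linear syz T 1 -> C}.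
have [I IE] := dsum_map_exists X (syz_incl 0).
have [P PE] := dsum_map_exists X (aug T).
have IP := dsum_short_exact IE PE (syz_short_exact 0).
have [E [j [h [q [jq hI qh]]]]] := pushout (copair (fun f : X => f) : {linear _ -> _}) IP.
have [j_inj q_epi ex] := jq.
exists E, j; split=> // u.
have [w wE] := extT X (q \o u).
have [w' w'E] := @free_projective R _ _ _ q w q_epi.
have uw x : exists y, j y = (u \- (w' \o syz_incl 0)) x.
  by apply/ex; rewrite /= linearB w'E wE /= subrr.
have [f fE] := factor_through_mono j_inj uw.
exists (w' \+ (h \o (dsum_in f : {linear _ -> _}))) => x /=.
have -> : dsum_in f (syz_incl 0 x) = I (dsum_in f x).
  by apply: dsum_ext => k; rewrite IE !dsum_inE; case: asboolP; rewrite ?linear0.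
by rewrite hI /= copair_in fE /= addrC subrK.
Qed.

(** The complement that membership in Add T asks for is a zero module. *)
Lemma Gen_dsum (X : Type) : Gen T (dsum X T).
Proof.
pose Z : lmodType R := ker (idfun : {linear T -> T}).
have Z0 (z : Z) : z = 0 by apply: val_inj; case: z => z /= /eqP.
exists (dsum X T), idfun; split; last by move=> y; exists y.
exists X, Z, fst; exists (fun c => (c, 0)) => [[c z]|//].
by rewrite (Z0 z).
Qed.

Lemma Gen_quotient (M N : lmodType R) (p : {linear M -> N}) :
  epi p -> Gen T M -> Gen T N.
Proof.
move=> p_epi [A [f [AddA f_epi]]]; exists A, (p \o f); split=> // y.
by have [x <-] := p_epi y; have [a <-] := f_epi x; exists a.
Qed.

(** A map from a direct summand of T^(J), extended by zero to T^(J), is determined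
    by its restrictions to the copies of T. *)
Lemma Gen_hom_zero (M : lmodType R) : Gen T M -> is_zero (Hom T M) -> is_zero M.
Proof.
move=> [A [f [[J [N [b b_bij]]] f_epi]]] hom0 x.
have [a <-] := f_epi x.
have b_epi : epi b by case: b_bij => b' _ b'K y; exists (b' y).
have [|g gE] := @factor_through_epi R M _ _ b (f \o fst) b_epi.
  by move=> y; rewrite -[RHS](linear0 b) => /(bij_inj b_bij) ->; rewrite /= linear0.
have -> : f a = g (b (a, 0)) by rewrite gE.
apply: (dsum_linear_ext (v := \0)) => k t.
exact: (congr1 (fun u : Hom T M => u t) (hom0 (g \o (dsum_in k : {linear T -> _})))).
Qed.

(** L is the trace of T in M, obtained as the kernel of the cokernel of the
    evaluation map T^(Hom(T, M)) -> M. *)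
Lemma trace_short_exact (M : lmodType R) :
  exists (L N : lmodType R) (j : {linear L -> M}) (p : {linear M -> N}),
    [/\ short_exact j p, Gen T L & forall (f : {linear T -> M}) t, p (f t) = 0].
Proof.
pose ev : {linear dsum (Hom T M) T -> M} := copair (fun f : Hom T M => f).
have [N [p [p_epi ex]]] := coker_exists ev.
have jp := ker_short_exact p_epi; have [j_inj _ exk] := jp.
exists (ker p), N, (ker_incl p), p; split=> // [|f t]; last first.
  by apply/ex; exists (dsum_in (f : Hom T M) t); rewrite /ev /= copair_in.
have evk c : exists y, ker_incl p y = ev c by apply/exk/ex; exists c.
have [e eE] := factor_through_mono j_inj evk.
apply: (@Gen_quotient _ _ e); last exact: Gen_dsum.
move=> y; have /ex[c cE] : p (ker_incl p y) = 0 by apply/exk; exists y.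
exists c; apply/eqP; rewrite -subr_eq0; apply/eqP; apply: j_inj.
by rewrite linearB eE cE subrr.
Qed.

Lemma tilting_ext0 (N : lmodType R) : tilting T -> Gen T N <-> ext_zero 0 N.
Proof.
move=> tiltT; rewrite -ext_zeroP; apply: iff_trans (tiltT N) _.
by split=> [ext|ext i ->//]; apply: (ext 1%N).
Qed.

(** A tilting module has projective dimension at most one. *)
Lemma tilting_ext1 : tilting T -> forall M, ext_zero 1 M.
Proof.
move=> tiltT M g; have ext_Gen := tilting_ext0 ^~ tiltT.
have [C [i [h [_ [[i_inj _ _] hg _]]]]] := pushout g (syz_short_exact 1).
have [|E [j [j_inj extE]]] := @ext_zero_envelope C.
  by move=> X; apply/ext_Gen/Gen_dsum.
have [|N [p jp]] := @mono_short_exact R _ _ (j \o i).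
  by move=> x /j_inj/i_inj.
have [_ p_epi _] := jp.
apply: (ext_zero_shift (h := j \o h) jp) => [|x]; last by rewrite /= hg.
exact/ext_Gen/(Gen_quotient p_epi)/ext_Gen.
Qed.

End Ext.

Local Close Scope ring_scope.

Theorem theorem3p11 (R : pzRingType) (T : lmodType R) (perfR : perfect R) :
  tilting T <->
    (forall M : lmodType R, perp [set i | 0 <= i <= 1] T M -> is_zero M) /\
    (forall M : lmodType R, Gen T M -> perp [set i | 1 <= i <= 2] T M).
Proof.
split=> [tiltT|[perp0 GenT] M].
  have ext_Gen N := tilting_ext0 N tiltT; split=> M.
    move=> ext01; apply: Gen_hom_zero (ext01 0 _) => //.
    by apply/ext_Gen/ext_zeroP/(ext01 1).
  move=> GenM [|[|[|i]]] //= _; apply/ext_zeroP; first exact/ext_Gen.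
  exact: tilting_ext1.
split=> [GenM i ->|ext1]; first exact: GenT.
have extM : ext_zero T 0 M by apply/ext_zeroP/(ext1 1).
have [L [N [j [p [jp GenL pT]]]]] := trace_short_exact T M.
have [extL1 extL2] : ext_zero T 0 L /\ ext_zero T 1 L.
  by split; apply/ext_zeroP; [apply: (GenT L GenL 1)|apply: (GenT L GenL 2)].
have N0 : is_zero N.
  apply: perp0 => -[|[|i]] //= _; last first.
    exact/ext_zeroP/(ext_zero_quotient jp).
  move=> f; apply: hom_ext => t; have [g gE] := ext_zero_lift jp extL1 f.
  by rewrite -gE pT.
apply: (Gen_quotient (p := j)) => // y.
by have [_ _ ex] := jp; apply/ex/N0.
Qed.
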